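(* Let $s,n\ge 1$ be integers and let $\Omega$ and $\Omega_1,\ldots,\Omega_n$ be nonempty closed convex subsets of $\mathbb{R}^s$ such that $\Omega_i\cap\Omega=\emptyset$ for all $i=1,\ldots,n$. Consider the generalized Heron problem $$\text{minimize } D(x):=\sum_{i=1}^n d(x;\Omega_i)\quad\text{subject to } x\in\Omega.$$ Given $\bar x\in\Omega$, define the (nonzero) vectors $$a_i(\bar x):=\frac{\bar x-\Pi(\bar x;\Omega_i)}{d(\bar x;\Omega_i)},\qquad i=1,\ldots,n.$$ Then $\bar x$ is an optimal solution to the generalized Heron problem if and only if $$-\sum_{i=1}^n a_i(\bar x)\in N(\bar x;\Omega).$$ Suppose in addition that $\Omega$ has a tangent space $L$ at $\bar x$. Then the inclusion $-\sum_{i=1}^n a_i(\bar x)\in N(\bar x;\Omega)$ is equivalent to $$\sum_{i=1}^n\cos\big(a_i(\bar x),u\big)=0\quad\text{for all } u\in L\setminus\{0\}.$$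
   Context: $\langle\cdot,\cdot\rangle$ and $\|\cdot\|$ are the usual scalar product and Euclidean norm on $\mathbb{R}^s$. For a nonempty set $A\subset\mathbb{R}^s$, $d(x;A):=\inf\{\|x-y\| : y\in A\}$; for $A$ nonempty, closed and convex, $\Pi(x;A)$ denotes the unique point $y\in A$ with $\|x-y\|=d(x;A)$ (the Euclidean projection). An optimal solution of the problem is a point $\bar x\in\Omega$ with $D(\bar x)\le D(x)$ for all $x\in\Omega$. For a convex set $\Omega$ and $\bar x\in\Omega$, the normal cone is $N(\bar x;\Omega):=\{v\in\mathbb{R}^s : \langle v,x-\bar x\rangle\le 0 \text{ for all } x\in\Omega\}$. For nonzero $u,v\in\mathbb{R}^s$, $\cos(v,u):=\frac{\langle v,u\rangle}{\|v\|\,\|u\|}$. One says that $\Omega$ has a tangent space $L$ at $\bar x$ if $L\neq\{0\}$ is a linear subspace of $\mathbb{R}^s$ such that $N(\bar x;\Omega)=L^\perp:=\{v\in\mathbb{R}^s : \langle v,u\rangle=0 \text{ for all } u\in L\}$. *)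

(* Defs.v *)
From mathcomp Require Export all_boot all_order all_algebra.
From mathcomp Require Export all_classical all_reals all_analysis.

Set Implicit Arguments.
Unset Strict Implicit.
Unset Printing Implicit Defensive.

Import Order.TTheory GRing.Theory Num.Theory.
Export numFieldNormedType.Exports.

Local Open Scope classical_set_scope.
Local Open Scope ring_scope.

(* R^s is 'rV[R]_s.  The library norm `|x| on 'rV[R]_s is the max norm, so the
   Euclidean norm is defined here; the library topology (product topology),
   used for [closed], is the Euclidean one. *)
Definition dotv (R : realType) (s : nat) (u v : 'rV[R]_s) : R :=
  \sum_(k < s) u 0 k * v 0 k.

Definition enorm (R : realType) (s : nat) (u : 'rV[R]_s) : R :=
  Num.sqrt (dotv u u).

Definition dist (R : realType) (s : nat) (x : 'rV[R]_s) (A : set 'rV[R]_s) : R :=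
  inf [set enorm (x - y) | y in A].

(* The value is the default 0 when no nearest point exists, which cannot happen
   for A nonempty and closed; the nearest point is unique when A is convex. *)
Definition eproj (R : realType) (s : nat) (x : 'rV[R]_s) (A : set 'rV[R]_s) :
    'rV[R]_s :=
  xget 0 [set y | A y /\ enorm (x - y) = dist x A].

Definition normal_cone (R : realType) (s : nat) (x : 'rV[R]_s)
    (A : set 'rV[R]_s) : set 'rV[R]_s :=
  [set v | forall y, A y -> dotv v (y - x) <= 0].

Definition vcos (R : realType) (s : nat) (v u : 'rV[R]_s) : R :=
  dotv v u / (enorm v * enorm u).

Definition orthogonal_space (R : realType) (s : nat) (L : {vspace 'rV[R]_s}) :
    set 'rV[R]_s :=
  [set v | forall u, u \in L -> dotv v u = 0].

Definition has_tangent_space (R : realType) (s : nat) (A : set 'rV[R]_s)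
    (x : 'rV[R]_s) (L : {vspace 'rV[R]_s}) : Prop :=
  L != 0%VS /\ normal_cone x A = orthogonal_space L.

Definition heron_cost (R : realType) (s n : nat) (Omegas : 'I_n -> set 'rV[R]_s)
    (x : 'rV[R]_s) : R :=
  \sum_(i < n) dist x (Omegas i).

Definition heron_optimal (R : realType) (s n : nat) (Omega : set 'rV[R]_s)
    (Omegas : 'I_n -> set 'rV[R]_s) (x : 'rV[R]_s) : Prop :=
  Omega x /\ forall y, Omega y -> heron_cost Omegas x <= heron_cost Omegas y.

Definition heron_dir (R : realType) (s n : nat) (Omegas : 'I_n -> set 'rV[R]_s)
    (x : 'rV[R]_s) (i : 'I_n) : 'rV[R]_s :=
  (dist x (Omegas i))^-1 *: (x - eproj x (Omegas i)).

(* Main.v *)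
(* Write a_i for the unit vector along x - p_i, p_i being the projection of x on
   Omega_i.  Convexity makes a_i a subgradient of the distance function d_i at x,
   so if <sum a_i, y - x> >= 0 on Omega then D(y) >= D(x) there.  Conversely
   d_i(x + h) <= |x + h - p_i| <= d_i(x) + <a_i, h> + |h|^2 / (2 d_i(x)); taking
   h = t (y - x) and letting t tend to 0 turns optimality of x into
   <sum a_i, y - x> >= 0. *)
From mathcomp Require Import ring lra.
Require Import Defs.

Set Implicit Arguments.
Unset Strict Implicit.
Unset Printing Implicit Defensive.

Import Order.TTheory GRing.Theory Num.Theory.

Local Open Scope classical_set_scope.
Local Open Scope ring_scope.

(** Instead of dividing by [t] and letting it tend to 0, one explicit [t] refutes [b < 0]. *)
Lemma ge0_of_quadratic_ge0 (R : realFieldType) (b k : R) : 0 <= k ->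
  (forall t, 0 < t -> t <= 1 -> 0 <= t * b + t ^+ 2 * k) -> 0 <= b.
Proof.
move=> k0 bk; rewrite leNgt; apply/negP => b0.
have kb : 0 < k - b by lra.
(* The root [- b / k] moved towards 0: the denominator [k - b] is positive even if [k = 0] and keeps
   the value at most 1. *)
have t0 : 0 < - b / (k - b) by rewrite divr_gt0 // oppr_gt0.
have t1 : - b / (k - b) <= 1 by rewrite ler_pdivrMr //; lra.
have := bk _ t0 t1.
set t := - b / (k - b) in t0 t1 *.
have -> : t * b + t ^+ 2 * k = - (t * b ^+ 2 / (k - b)).
  by rewrite /t; field; rewrite gt_eqF.
rewrite oppr_ge0 leNgt => /negP; apply.
by rewrite divr_gt0 // mulr_gt0 // exprn_even_gt0 //= lt_eqF.
Qed.

(** * Scalar product and Euclidean norm *)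

Section EuclideanSpace.
Variables (R : realType) (s : nat).
Implicit Types (u v w x y : 'rV[R]_s) (A : set 'rV[R]_s).

Lemma dotvC u v : dotv u v = dotv v u.
Proof. by apply: eq_bigr => k _; rewrite mulrC. Qed.

Lemma dotvDl u v w : dotv (u + v) w = dotv u w + dotv v w.
Proof.
by rewrite /dotv -big_split; apply: eq_bigr => k _; rewrite mxE mulrDl.
Qed.

Lemma dotvZl a u v : dotv (a *: u) v = a * dotv u v.
Proof.
by rewrite /dotv mulr_sumr; apply: eq_bigr => k _; rewrite mxE mulrA.
Qed.

Lemma dotvNl u v : dotv (- u) v = - dotv u v.
Proof. by rewrite -scaleN1r dotvZl mulN1r. Qed.

Lemma dotv0l v : dotv 0 v = 0.
Proof. by rewrite -(scale0r v) dotvZl mul0r. Qed.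

Lemma dotvDr u v w : dotv u (v + w) = dotv u v + dotv u w.
Proof. by rewrite dotvC dotvDl !(dotvC u). Qed.

Lemma dotvZr a u v : dotv u (a *: v) = a * dotv u v.
Proof. by rewrite dotvC dotvZl (dotvC u). Qed.

Lemma dotvNr u v : dotv u (- v) = - dotv u v.
Proof. by rewrite dotvC dotvNl (dotvC u). Qed.

Lemma dotv_suml (I : finType) (F : I -> 'rV[R]_s) v :
  dotv (\sum_i F i) v = \sum_i dotv (F i) v.
Proof.
exact: (big_morph (fun u => dotv u v) (fun u w => dotvDl u w v) (dotv0l v)).
Qed.

Definition dotvE := (dotvDl, dotvDr, dotvNl, dotvNr, dotvZl, dotvZr).

Lemma dotvv_ge0 u : 0 <= dotv u u.
Proof. by apply: sumr_ge0 => k _; rewrite -expr2 sqr_ge0. Qed.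

Lemma enorm_ge0 u : 0 <= enorm u.
Proof. exact: sqrtr_ge0. Qed.

Lemma sqr_enorm u : enorm u ^+ 2 = dotv u u.
Proof. by rewrite sqr_sqrtr // dotvv_ge0. Qed.

Lemma ler_enorm u v : (enorm u <= enorm v) = (dotv u u <= dotv v v).
Proof. by rewrite ler_sqrt // dotvv_ge0. Qed.

Lemma normr_coord_le_enorm u k : `|u 0 k| <= enorm u.
Proof.
rewrite -sqrtr_sqr ler_wsqrtr // /dotv (bigD1 k) //= -expr2 lerDl.
by apply: sumr_ge0 => j _; rewrite -expr2 sqr_ge0.
Qed.

(** Carries boundedness and nonvanishing between the max norm of the library and the Euclidean
    norm. *)
Lemma normr_le_enorm u : `|u| <= enorm u.
Proof.
rewrite [`|u|]mx_normrE; apply: bigmax_le => [|[i k] _ /=].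
  exact: enorm_ge0.
by rewrite (ord1 i) normr_coord_le_enorm.
Qed.

Lemma enorm_gt0 u : (0 < enorm u) = (u != 0).
Proof.
apply/idP/idP => [|u0].
  by apply: contraTneq => ->; rewrite /enorm dotv0l sqrtr0 ltxx.
by apply: lt_le_trans (normr_le_enorm u); rewrite normr_gt0.
Qed.

(** Cauchy-Schwarz for a unit vector: the residual of [v] along [u] has squared norm
    [dotv v v - dotv u v ^+ 2]. *)
Lemma dotv_le_enorm u v : dotv u u = 1 -> dotv u v <= enorm v.
Proof.
move=> u1; have := dotvv_ge0 (v - dotv u v *: u).
rewrite !dotvE u1 (dotvC v u) => h.
apply: le_trans (ler_norm _) _.
by rewrite -sqrtr_sqr ler_wsqrtr //; nra.
Qed.

(* AM-GM, in the form 0 <= (enorm u - d) ^+ 2. *)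
Lemma enorm_le_tangent u d : 0 < d -> enorm u <= (dotv u u + d ^+ 2) / (2 * d).
Proof.
move=> d0; rewrite ler_pdivlMr ?mulr_gt0 // -sqr_enorm.
by have := sqr_ge0 (enorm u - d); lra.
Qed.

Lemma continuous_enorm_sub x : continuous (fun y => enorm (x - y)).
Proof.
suff cd : continuous (fun y => dotv (x - y) (x - y)).
  move=> y; exact: continuous_comp (cd y) (@sqrt_continuous _ _).
rewrite /dotv; apply: continuous_big => [|k _ y]; first exact: add_continuous.
have c : (fun z : 'rV[R]_s => (x - z) 0 k) z @[z --> y] --> (x - y) 0 k.
  rewrite !mxE; under eq_fun do rewrite !mxE.
  exact: (@cvgB R R^o _ _ _ (fun=> x 0 k) (fun z : 'rV[R]_s => z 0 k) _ _
    (cvg_cst _) (@coord_continuous R 1 s 0 k y)).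
exact: (cvgM c c).
Qed.

Lemma convex_segment A x y t : convex_set A -> A x -> A y ->
  0 <= t -> t <= 1 -> A (x + t *: (y - x)).
Proof.
move=> cA Ax Ay t0 t1.
(* The library's convex combination puts the weight [t] on its first point, hence [y] before [x]. *)
have := cA y x (Itv01 t0 t1) (mem_set Ay) (mem_set Ax).
move/set_mem; congr (A _).
rewrite /conv /= scalerBl scale1r scalerBr.
by rewrite addrCA addrA.
Qed.

(** * Distance and projection *)

Lemma dist_le x y A : A y -> dist x A <= enorm (x - y).
Proof.
move=> Ay; apply: ge_inf; last by exists y.
by exists 0 => _ [z _ <-]; exact: enorm_ge0.
Qed.

(** The part [B] of [A] no farther from [x] than [a] is compact, so the extreme value theorem
    applies; the other points of [A] are farther than [a]. *)
Lemma dist_attained x A : A !=set0 -> closed A ->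
  exists2 y, A y & enorm (x - y) = dist x A.
Proof.
move=> [a Aa] clA; pose B := A `&` [set y | enorm (x - y) <= enorm (x - a)].
have clB : closed B.
  apply: closedI => //.
  apply: (@preimage_closed _ _ _ [set r : R | r <= enorm (x - a)]).
    by move=> y _; exact: continuous_enorm_sub.
  exact: closed_le.
have bndB : bounded_set B.
  exists (`|x| + enorm (x - a)); split; first exact: num_real.
  move=> M ltM y [_ /= yB]; apply/ltW/le_lt_trans/ltM.
  rewrite -[y in `|y|](subKr x) (le_trans (ler_normB _ _)) // lerD2l.
  exact: le_trans (normr_le_enorm _) yB.
have [y /set_mem[Ay yB] ymin] := EVT_min_rV (ex_intro _ a (conj Aa (lexx _)))
  (bounded_closed_compact bndB clB)
  (continuous_subspaceT (@continuous_enorm_sub x)).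
exists y => //; apply/eqP; rewrite eq_le dist_le // andbT.
apply: lb_le_inf; first by exists (enorm (x - a)), a.
move=> _ [z Az <-]; have [za|/ltW az] := leP (enorm (x - z)) (enorm (x - a)).
  by apply: ymin; rewrite inE.
exact: le_trans yB az.
Qed.

(** Attainment excludes the default value of [xget]. *)
Lemma eprojP x A : A !=set0 -> closed A ->
  A (eproj x A) /\ enorm (x - eproj x A) = dist x A.
Proof.
move=> A0 clA; have [y Ay xy] := dist_attained x A0 clA.
by apply: (@xgetPex _ 0 [set y | A y /\ enorm (x - y) = dist x A]); exists y.
Qed.

(** Moving from the projection towards [y] stays in [A] and cannot reduce the distance to [x]; the
    first-order term in [t] gives the sign. *)
Lemma eproj_obtuse x y A : closed A -> convex_set A -> A y ->
  dotv (x - eproj x A) (y - eproj x A) <= 0.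
Proof.
move=> clA cA Ay; have [] := eprojP x (ex_intro _ y Ay) clA.
move: (eproj x A) => p Ap xp.
suff : 0 <= - (2 * dotv (x - p) (y - p)) by lra.
apply: (ge0_of_quadratic_ge0 (dotvv_ge0 (y - p))) => t t0 t1.
have := dist_le x (convex_segment cA Ap Ay (ltW t0) t1).
rewrite -xp ler_enorm opprD addrA; move: (x - p) (y - p) => u v.
by rewrite !dotvE (dotvC v u); lra.
Qed.

(** [heron_dir] for a single set; off a closed convex [A], the gradient of the distance. *)
Definition dist_dir x A := (dist x A)^-1 *: (x - eproj x A).

Lemma dist_gt0 x A : A !=set0 -> closed A -> ~ A x -> 0 < dist x A.
Proof.
move=> A0 clA nAx; have [Ap <-] := eprojP x A0 clA.
by rewrite enorm_gt0 subr_eq0; apply: contra_notN nAx => /eqP ->.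
Qed.

Section DistanceDirection.
Variables (A : set 'rV[R]_s) (x : 'rV[R]_s).
Hypotheses (A_neq0 : A !=set0) (clA : closed A) (nAx : ~ A x).

Let dist_neq0 : dist x A != 0.
Proof. by rewrite gt_eqF // dist_gt0. Qed.

Let dotv_sub_eproj : dotv (x - eproj x A) (x - eproj x A) = dist x A ^+ 2.
Proof. by rewrite -sqr_enorm; have [_ ->] := eprojP x A_neq0 clA. Qed.

Lemma dotv_dist_dir : dotv (dist_dir x A) (dist_dir x A) = 1.
Proof.
by rewrite dotvZl dotvZr dotv_sub_eproj expr2 mulKf ?mulVf.
Qed.

Lemma dist_dir_neq0 : dist_dir x A != 0.
Proof.
apply/eqP => a0; have := dotv_dist_dir.
by rewrite a0 dotv0l => /esym/eqP; rewrite oner_eq0.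
Qed.

(* The supporting hyperplane of [A] at the projection of [x] has unit normal
   [dist_dir x A]. *)
Lemma dist_subgradient y : convex_set A ->
  dist x A + dotv (dist_dir x A) (y - x) <= dist y A.
Proof.
move=> cA; have [q Aq <-] := dist_attained y A_neq0 clA.
(* The length of [y - q] is at least its component along the unit normal; in the splitting below,
   [x - eproj x A] contributes [dist x A] and [eproj_obtuse] signs the last term. *)
apply: le_trans (dotv_le_enorm _ dotv_dist_dir).
have -> : y - q = (y - x) + ((x - eproj x A) - (q - eproj x A)).
  by rewrite opprB !subrKA.
move: (y - x) => w; rewrite dotvDr [leLHS]addrC lerD2l.
rewrite [leRHS]dotvDr dotvNr [X in X - _]dotvZl dotv_sub_eproj
  expr2 mulKf // lerDl oppr_ge0 dotvZl.
by rewrite pmulr_rle0 ?invr_gt0 ?dist_gt0 // eproj_obtuse.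
Qed.

(** The projection of [x] remains a competitor at [x + h]; the tangent bound with [d = dist x A]
    removes the square root. *)
Lemma dist_quadratic_upper_bound h :
  dist (x + h) A <=
    dist x A + dotv (dist_dir x A) h + dotv h h / (2 * dist x A).
Proof.
have [Ap _] := eprojP x A_neq0 clA.
apply: le_trans (dist_le _ Ap) _.
apply: le_trans (enorm_le_tangent _ (dist_gt0 A_neq0 clA nAx)) _.
have -> : dotv (x + h - eproj x A) (x + h - eproj x A) =
    dist x A ^+ 2 + 2 * dotv (x - eproj x A) h + dotv h h.
  rewrite -dotv_sub_eproj addrAC; move: (x - eproj x A) => w.
  by rewrite !dotvE (dotvC h w); ring.
rewrite dotvZl le_eqVlt; apply/orP; left; apply/eqP.
by field.
Qed.

End DistanceDirection.
End EuclideanSpace.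

Theorem theorem3p2 (R : realType) (s n : nat) (hs : (1 <= s)%N) (hn : (1 <= n)%N)
    (Omega : set 'rV[R]_s) (Omegas : 'I_n -> set 'rV[R]_s)
    (Omega_neq0 : Omega !=set0) (Omega_closed : closed Omega)
    (Omega_convex : convex_set Omega)
    (Omegas_neq0 : forall i, Omegas i !=set0)
    (Omegas_closed : forall i, closed (Omegas i))
    (Omegas_convex : forall i, convex_set (Omegas i))
    (disj : forall i, Omegas i `&` Omega = set0)
    (x : 'rV[R]_s) (Omega_x : Omega x) :
  [/\ (forall i, heron_dir Omegas x i != 0),
      heron_optimal Omega Omegas x <->
        normal_cone x Omega (- \sum_(i < n) heron_dir Omegas x i) &
      forall L : {vspace 'rV[R]_s}, has_tangent_space Omega x L ->
        (normal_cone x Omega (- \sum_(i < n) heron_dir Omegas x i) <->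
         forall u : 'rV[R]_s, u \in L -> u != 0 ->
           \sum_(i < n) vcos (heron_dir Omegas x i) u = 0)].
Proof.
have nx i : ~ Omegas i x.
  by move=> Oix; have : (Omegas i `&` Omega) x by []; rewrite disj.
have d_gt0 i : 0 < dist x (Omegas i) by exact: dist_gt0.
have dir1 i : dotv (heron_dir Omegas x i) (heron_dir Omegas x i) = 1.
  exact: dotv_dist_dir.
split.
- by move=> i; exact: dist_dir_neq0.
- split=> [[_ opt] y Oy|ncone].
    rewrite dotvNl oppr_le0 dotv_suml.
    (* [K] collects the second-order terms of the upper bounds along [y - x]. *)
    pose K := \sum_(i < n) dotv (y - x) (y - x) / (2 * dist x (Omegas i)).
    apply: (@ge0_of_quadratic_ge0 _ _ K).
      by apply: sumr_ge0 => i _; rewrite divr_ge0 ?dotvv_ge0 // mulr_ge0 // ltW.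
    move=> t t0 t1.
    rewrite -(lerD2l (heron_cost Omegas x)) addr0.
    (* Optimality is tested at the feasible point [x + t *: (y - x)], then each distance is bounded
       separately. *)
    apply: le_trans (opt _ (convex_segment Omega_convex Omega_x Oy (ltW t0) t1)) _.
    rewrite /K !mulr_sumr -!big_split; apply: ler_sum => i _ /=.
    have := dist_quadratic_upper_bound (Omegas_neq0 i) (Omegas_closed i) (@nx i)
      (t *: (y - x)).
    by rewrite dotvZr [dotv (t *: _) _]dotvZl dotvZr !mulrA -expr2 addrA.
  split=> // y Oy; have := ncone y Oy.
  rewrite dotvNl oppr_le0 dotv_suml => h.
  apply: (@le_trans _ _ (heron_cost Omegas x +
    \sum_(i < n) dotv (heron_dir Omegas x i) (y - x))); first by rewrite lerDl.
  by rewrite -big_split; apply: ler_sum => i _; exact: dist_subgradient.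
- move=> L [_ ->].
  (* As the directions are unit vectors, all cosines share the denominator [enorm u]. *)
  have sum_vcos u : \sum_(i < n) vcos (heron_dir Omegas x i) u =
      dotv (\sum_(i < n) heron_dir Omegas x i) u / enorm u.
    rewrite dotv_suml mulr_suml; apply: eq_bigr => i _.
    by rewrite /vcos /enorm dir1 sqrtr1 mul1r.
  split=> [orth u uL _|cos0 u uL].
    by apply/eqP; rewrite sum_vcos -oppr_eq0 -mulNr -dotvNl orth // mul0r.
  (* The cosine condition omits [u = 0], where orthogonality is trivial. *)
  have [->|u0] := eqVneq u 0; first by rewrite dotvC dotv0l.
  have /eqP := cos0 u uL u0; rewrite sum_vcos mulf_eq0 invr_eq0.
  rewrite (gt_eqF (_ : 0 < enorm u)) ?enorm_gt0 // orbF dotvNl => /eqP ->.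
  by rewrite oppr0.
Qed.
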